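(* Let $\Omega=\{r<0\}\subset\mathbb{C}^2$ with $0\in b\Omega$, where $r(z,w)=\operatorname{Im} w+F(z,\bar z,\operatorname{Re}w,\operatorname{Im}w)$ and all terms of $F$ are of degree at least $2$. Suppose that there is a constant $C>0$ such that $|r_z|^2\le C\mathcal{L}_r$ on $b\Omega$ in a neighborhood of the origin. Then $\Omega$ has a local plurisubharmonic defining function on the boundary near the origin if and only if there exists a real-valued function $T$, with $1+T>0$ near the origin, such that on $b\Omega$ in a neighborhood of the origin $$\frac{\partial}{\partial z}\log(1+T)=-\frac{\partial}{\partial z}\log r_{\bar w}+E,\qquad |E|^2\le C'\left(\mathcal{L}_r+|r_z|^2\right)\ \text{ for some } C'>0.$$ Furthermore, for such a $T$, $\rho=(1+Kr+T)r$ is a local plurisubharmonic defining function on the boundary near the origin for some $K>0$.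
   Context: Coordinates on $\mathbb{C}^2$ are $(z,w)$; subscripts denote partial derivatives, e.g. $r_z=\partial r/\partial z$, $r_{z\bar w}=\partial^2 r/\partial z\,\partial\bar w$. All functions are assumed smooth. A real-valued function $r$ is a defining function for $\Omega$ if $\Omega=\{r<0\}$ and $\nabla r\neq0$ on the boundary $b\Omega$. The normalization of $r$ guarantees $r_w\neq0$ near the origin. A local plurisubharmonic defining function on the boundary near $0$ is a real-valued function $\rho$, defined near $0$, such that for some neighborhood $V$ of $0$: $\Omega\cap V=\{\rho<0\}\cap V$, $\nabla\rho\neq0$ on $b\Omega\cap V$, and the complex Hessian matrix of $\rho$ is positive semidefinite (on all vectors of $\mathbb{C}^2$) at every point of $b\Omega\cap V$. The Levi form is $$\mathcal{L}_r=r_{z\bar z}|r_w|^2+r_{w\bar w}|r_z|^2-2\operatorname{Re}[r_{z\bar w}r_wr_{\bar z}].$$ The logarithmic derivatives mean $\frac{\partial}{\partial z}\log(1+T)=T_z/(1+T)$ and $\frac{\partial}{\partial z}\log r_{\bar w}=r_{z\bar w}/r_{\bar w}$. *)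

(* Defs.v *)
From Stdlib Require Export Reals.
From Coquelicot Require Export Coquelicot.

Open Scope R_scope.

Notation C2 := (C * C)%type.

Definition origin : C2 := (RtoC 0, RtoC 0).

(* The four real coordinates of (z, w) = (x + iy, u + iv). *)
Inductive coord := cx | cy | cu | cv.

Definition coordinate (k : coord) (p : C2) : R :=
  match k with
  | cx => Re (fst p) | cy => Im (fst p)
  | cu => Re (snd p) | cv => Im (snd p)
  end.

(* The point p with its k-th real coordinate replaced by t. *)
Definition slice (k : coord) (p : C2) (t : R) : C2 :=
  match k with
  | cx => ((t, Im (fst p)), snd p)
  | cy => ((Re (fst p), t), snd p)
  | cu => (fst p, (t, Im (snd p)))
  | cv => (fst p, (Re (snd p), t))
  end.

Definition partial (k : coord) (f : C2 -> R) (p : C2) : R :=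
  Derive (fun t => f (slice k p t)) (coordinate k p).

Definition ex_partial (k : coord) (f : C2 -> R) (p : C2) : Prop :=
  ex_derive (fun t => f (slice k p t)) (coordinate k p).

Fixpoint Ck_on (n : nat) (U : C2 -> Prop) (f : C2 -> R) : Prop :=
  (forall p, U p -> continuous f p) /\
  match n with
  | O => True
  | S m => forall k, (forall p, U p -> ex_partial k f p)
                     /\ Ck_on m U (partial k f)
  end.

(* Meant for open U. *)
Definition smooth_on (U : C2 -> Prop) (f : C2 -> R) : Prop :=
  forall n, Ck_on n U f.

Definition smooth_near_origin (f : C2 -> R) : Prop :=
  exists U : C2 -> Prop, open U /\ U origin /\ smooth_on U f.

Definition Csmooth_near_origin (g : C2 -> C) : Prop :=
  smooth_near_origin (fun p => Re (g p)) /\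
  smooth_near_origin (fun p => Im (g p)).

Definition Cpartial (k : coord) (g : C2 -> C) (p : C2) : C :=
  (partial k (fun q => Re (g q)) p, partial k (fun q => Im (g q)) p).

Definition d_z (g : C2 -> C) (p : C2) : C :=
  ((Cpartial cx g p - Ci * Cpartial cy g p) / 2)%C.
Definition d_zbar (g : C2 -> C) (p : C2) : C :=
  ((Cpartial cx g p + Ci * Cpartial cy g p) / 2)%C.
Definition d_w (g : C2 -> C) (p : C2) : C :=
  ((Cpartial cu g p - Ci * Cpartial cv g p) / 2)%C.
Definition d_wbar (g : C2 -> C) (p : C2) : C :=
  ((Cpartial cu g p + Ci * Cpartial cv g p) / 2)%C.

Definition toC (f : C2 -> R) : C2 -> C := fun p => RtoC (f p).

(* r_{z zbar} and r_{w wbar} are real when r is smooth and real-valued, so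
   taking their real parts only changes the type. *)
Definition levi (r : C2 -> R) (p : C2) : R :=
  Re (d_z (d_zbar (toC r)) p) * (Cmod (d_w (toC r) p)) ^ 2
  + Re (d_w (d_wbar (toC r)) p) * (Cmod (d_z (toC r) p)) ^ 2
  - 2 * Re (d_z (d_wbar (toC r)) p * d_w (toC r) p * d_zbar (toC r) p)%C.

Definition hessian_form (f : C2 -> R) (p : C2) (a b : C) : C :=
  (d_z (d_zbar (toC f)) p * a * Cconj a
   + d_z (d_wbar (toC f)) p * a * Cconj b
   + d_w (d_zbar (toC f)) p * b * Cconj a
   + d_w (d_wbar (toC f)) p * b * Cconj b)%C.

(* The complex Hessian of a smooth real-valued function is Hermitian, so its
   quadratic form takes real values. *)
Definition hessian_psd (f : C2 -> R) (p : C2) : Prop :=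
  forall a b : C, 0 <= Re (hessian_form f p a b).

Definition grad_nonzero (f : C2 -> R) (p : C2) : Prop :=
  exists k, partial k f p <> 0.

Definition boundary (Om : C2 -> Prop) (p : C2) : Prop :=
  forall V : C2 -> Prop, locally p V ->
    (exists q, V q /\ Om q) /\ (exists q, V q /\ ~ Om q).

Definition defining_function (Om : C2 -> Prop) (r : C2 -> R) : Prop :=
  smooth_on (fun _ => True) r /\
  (forall p, Om p <-> r p < 0) /\
  (forall p, boundary Om p -> grad_nonzero r p).

Definition local_psh_defining_function
    (Om : C2 -> Prop) (rho : C2 -> R) : Prop :=
  exists V : C2 -> Prop,
    open V /\ V origin /\ smooth_on V rho /\
    (forall p, V p -> (Om p <-> rho p < 0)) /\
    (forall p, V p -> boundary Om p ->
       grad_nonzero rho p /\ hessian_psd rho p).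

(* The logarithmic derivatives are written out: d_z log(1+T) = T_z / (1+T)
   and d_z log r_wbar = r_{z wbar} / r_wbar. *)
Definition admissible_factor
    (Om : C2 -> Prop) (r : C2 -> R) (T : C2 -> R) : Prop :=
  smooth_near_origin T /\
  locally origin (fun p => 0 < 1 + T p) /\
  exists E : C2 -> C, Csmooth_near_origin E /\
  exists C' : R, 0 < C' /\
    locally origin (fun p => boundary Om p ->
      (d_z (toC T) p / RtoC (1 + T p)
         = - (d_z (d_wbar (toC r)) p / d_wbar (toC r) p) + E p)%C
      /\ (Cmod (E p)) ^ 2
           <= C' * (levi r p + (Cmod (d_z (toC r) p)) ^ 2)).

(* Main.v *)
Require Import Defs.
From Stdlib Require Import Psatz FunctionalExtensionality.

(** Write [P = r_z], [Q = r_w], [L] for the Levi form of [r], and let [rho] have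
    the same sign as [r].  On the boundary, to second order, [rho] behaves like
    a product [(g + (m/2) r) r]: its Hessian is
    [g r_jk + g_j r_k + g_k r_j + m r_j r_k].  For the product
    [(1 + K r + T) r] this is Leibniz's rule with [g = 1 + T] and [m = 2 K]
    ([rescaled_second_order]).  For an arbitrary [rho] one takes
    [g = rho_v / r_v], where [v = Im w]; the relation then follows by applying
    twice the fact that a function vanishing on the zero set of [r] has there a
    gradient proportional to that of [r] ([level_set_gradient],
    [zero_set_second_order]).

    Hence the complex Hessian of [rho] takes the value [g L] on the complex
    tangent [(Q, -P)], and its mixed entry is
    [b = g r_(z wbar) + g_z (Cconj Q) + O(|P|) = g (Cconj Q) E + O(|P|)],
    where [E = (log g)_z + (log r_wbar)_z] is the error in the equation for
    [T = g - 1].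

    If [rho] is plurisubharmonic on the boundary, the determinant inequality
    bounds [|b|^2] by a constant times [rho_(z zbar)], which positivity bounds
    in turn by [L + |P|^2]; so [E] satisfies the required estimate
    ([factor_from_psh]).

    Conversely, in the frame [(Q, -P)], [(0, 1)] the Hessian of
    [(1 + K r + T) r] has diagonal entries [g L] and about [2 K |Q|^2], and an
    off-diagonal entry independent of [K], of size [O(|E| + |P|)].  The
    hypothesis [|P|^2 <= C L] and the estimate on [E] make the square of that
    entry [O(L)], so the matrix is positive semidefinite once [K] is large
    ([psh_from_factor]). *)

(** * Slices and partial derivatives *)

Lemma coord_eq_dec (j k : coord) : {j = k} + {j <> k}.
Proof. decide equality. Qed.

Lemma slice_coordinate k p : slice k p (coordinate k p) = p.
Proof. now destruct k, p as [[x y] [u v]]. Qed.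

Lemma coordinate_slice k p t : coordinate k (slice k p t) = t.
Proof. now destruct k. Qed.

Lemma slice_slice k p s t : slice k (slice k p s) t = slice k p t.
Proof. now destruct k. Qed.

Lemma coordinate_slice_neq j k p s :
  j <> k -> coordinate k (slice j p s) = coordinate k p.
Proof. now destruct j, k. Qed.

Lemma slice_comm j k p s t :
  j <> k -> slice k (slice j p s) t = slice j (slice k p t) s.
Proof. now destruct j, k. Qed.

Lemma continuous_pair {A B D : UniformSpace} (f : A -> B) (g : A -> D) a :
  continuous f a -> continuous g a ->
  continuous (fun x => (f x, g x) : prod_UniformSpace B D) a.
Proof.
  intros Hf Hg; apply (continuous_comp_2 f g pair); auto.
  apply (continuous_ext (fun z => z)).
  - now intros [b d].
  - apply continuous_id.
Qed.

Lemma continuous_slice {A : UniformSpace} k (c : A -> C2) (t : A -> R) a :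
  continuous c a -> continuous t a ->
  continuous (fun x => slice k (c x) (t x) : C2) a.
Proof.
  intros Hc Ht.
  assert (H1 : continuous (fun x => fst (c x)) a)
    by (apply (continuous_comp c fst); [assumption|];
        destruct (c a); apply continuous_fst).
  assert (H2 : continuous (fun x => snd (c x)) a)
    by (apply (continuous_comp c snd); [assumption|];
        destruct (c a); apply continuous_snd).
  assert (F : forall z : A -> C, continuous z a ->
              continuous (fun x => Re (z x)) a).
  { intros z Hz; apply (continuous_comp z fst); [assumption|].
    destruct (z a); apply (continuous_fst (U := R_UniformSpace)). }
  assert (G : forall z : A -> C, continuous z a ->
              continuous (fun x => Im (z x)) a).
  { intros z Hz; apply (continuous_comp z snd); [assumption|].
    destruct (z a); apply (continuous_snd (U := R_UniformSpace)). }
  destruct k; simpl; repeat (apply @continuous_pair); auto.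
Qed.

Lemma continuous_slice_line k p t : continuous (slice k p) t.
Proof.
  apply (continuous_slice k (fun _ => p) (fun s => s)).
  - apply continuous_const.
  - apply continuous_id.
Qed.

Lemma locally_slice k p (P : C2 -> Prop) :
  locally p P -> locally (coordinate k p) (fun t => P (slice k p t)).
Proof.
  intros HP; apply (continuous_slice_line k p).
  now rewrite slice_coordinate.
Qed.

Lemma partial_ext_loc k (f g : C2 -> R) p :
  locally p (fun q => f q = g q) -> partial k f p = partial k g p.
Proof. intros H; apply Derive_ext_loc, (locally_slice k p _ H). Qed.

Lemma ex_partial_ext_loc k (f g : C2 -> R) p :
  locally p (fun q => f q = g q) -> ex_partial k f p -> ex_partial k g p.
Proof.
  intros H; apply (ex_derive_ext_loc _ _ _ (locally_slice k p _ H)).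
Qed.

Lemma partial_plus k f g p : ex_partial k f p -> ex_partial k g p ->
  partial k (fun q => f q + g q) p = partial k f p + partial k g p.
Proof. apply Derive_plus. Qed.

Lemma partial_scal k c f p : partial k (fun q => c * f q) p = c * partial k f p.
Proof. apply Derive_scal. Qed.

Lemma partial_const k c p : partial k (fun _ => c) p = 0.
Proof. exact (Derive_const c _). Qed.

Lemma partial_mult k f g p : ex_partial k f p -> ex_partial k g p ->
  partial k (fun q => f q * g q) p = partial k f p * g p + f p * partial k g p.
Proof.
  intros Hf Hg; unfold partial.
  rewrite (Derive_mult _ _ _ Hf Hg), slice_coordinate; reflexivity.
Qed.

Lemma ex_partial_plus k f g p : ex_partial k f p -> ex_partial k g p ->
  ex_partial k (fun q => f q + g q) p.
Proof. apply (ex_derive_plus (V := R_NormedModule)). Qed.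

Lemma ex_partial_const k c p : ex_partial k (fun _ => c) p.
Proof. exact (ex_derive_const (V := R_NormedModule) c _). Qed.

Lemma ex_partial_mult k f g p : ex_partial k f p -> ex_partial k g p ->
  ex_partial k (fun q => f q * g q) p.
Proof. apply ex_derive_mult. Qed.

Lemma partial_inv k f p : ex_partial k f p -> f p <> 0 ->
  partial k (fun q => / f q) p = - (partial k f p * (/ f p * / f p)).
Proof.
  intros Hf H0; unfold partial.
  rewrite Derive_inv; rewrite ?slice_coordinate; auto.
  field; auto.
Qed.

Lemma ex_partial_inv k f p : ex_partial k f p -> f p <> 0 ->
  ex_partial k (fun q => / f q) p.
Proof.
  intros Hf H0; apply ex_derive_inv; rewrite ?slice_coordinate; auto.
Qed.

(** * Smooth functions near a point *)

Lemma Ck_on_ext n U f g : open U -> (forall p, U p -> f p = g p) ->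
  Ck_on n U f -> Ck_on n U g.
Proof.
  intros HU; revert f g; induction n as [|n IH]; intros f g E [Hc Hd].
  all: assert (E' : forall p, U p -> locally p (fun q => f q = g q))
    by (intros p Hp; apply (filter_imp U); auto).
  all: split; [intros p Hp; apply (continuous_ext_loc _ f); auto|].
  - exact I.
  - intros k; destruct (Hd k) as [He Hk]; split.
    + intros p Hp; apply (ex_partial_ext_loc k f); auto.
    + apply (IH (partial k f)); auto.
      intros p Hp; apply partial_ext_loc; auto.
Qed.

Lemma Ck_on_sub n U V f : (forall p, V p -> U p) -> Ck_on n U f -> Ck_on n V f.
Proof.
  intros S; revert f; induction n as [|n IH]; intros f [Hc Hd]; split; auto.
  intros k; destruct (Hd k); auto.
Qed.

Lemma Ck_on_pred n U f : Ck_on (S n) U f -> Ck_on n U f.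
Proof.
  revert f; induction n as [|n IH]; intros f [Hc Hd]; split; auto.
  intros k; destruct (Hd k) as [He Hk]; auto.
Qed.

Lemma Ck_on_plus n U f g : open U ->
  Ck_on n U f -> Ck_on n U g -> Ck_on n U (fun p => f p + g p).
Proof.
  intros HU; revert f g; induction n as [|n IH]; intros f g [Hc Hd] [Gc Gd];
  (split; [intros p Hp;
     apply (continuous_plus (V := R_NormedModule)); auto|]).
  - exact I.
  - intros k; destruct (Hd k) as [He Hk], (Gd k) as [Ge Gk]; split.
    + intros p Hp; apply ex_partial_plus; auto.
    + apply (Ck_on_ext n U (fun p => partial k f p + partial k g p)); auto.
      intros p Hp; symmetry; apply partial_plus; auto.
Qed.

Lemma Ck_on_mult n U f g : open U ->
  Ck_on n U f -> Ck_on n U g -> Ck_on n U (fun p => f p * g p).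
Proof.
  intros HU; revert f g; induction n as [|n IH]; intros f g Hf Hg;
  pose proof Hf as [Hc Hd]; pose proof Hg as [Gc Gd];
  (split; [intros p Hp;
     apply (continuous_mult (K := R_AbsRing)); auto|]).
  - exact I.
  - intros k; destruct (Hd k) as [He Hk], (Gd k) as [Ge Gk]; split.
    + intros p Hp; apply ex_partial_mult; auto.
    + apply (Ck_on_ext n U
        (fun p => partial k f p * g p + f p * partial k g p)); auto.
      * intros p Hp; symmetry; apply partial_mult; auto.
      * apply Ck_on_plus; auto; apply IH; auto; now apply Ck_on_pred.
Qed.

Lemma Ck_on_const n U c : Ck_on n U (fun _ => c).
Proof.
  revert c; induction n as [|n IH]; intros c;
  (split; [intros p Hp; apply continuous_const|]).
  - exact I.
  - intros k; split.
    + intros p Hp; apply ex_partial_const.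
    + replace (partial k (fun _ : C2 => c)) with (fun _ : C2 => 0); auto.
      apply functional_extensionality; intros p; symmetry.
      apply partial_const.
Qed.

(** The derivative [- f' / f^2] is a product of [f'] with two copies of the
    inverse, so the induction needs only the inverse at the previous order. *)
Lemma Ck_on_inv n U f : open U -> (forall p, U p -> f p <> 0) ->
  Ck_on n U f -> Ck_on n U (fun p => / f p).
Proof.
  intros HU H0; induction n as [|n IH]; intros Hf;
  pose proof Hf as [Hc Hd];
  (split; [intros p Hp; apply (continuous_comp f Rinv); auto;
           apply continuous_Rinv; auto|]).
  - exact I.
  - intros k; destruct (Hd k) as [He Hk]; split.
    + intros p Hp; apply ex_partial_inv; auto.
    + assert (Hi := IH (Ck_on_pred _ _ _ Hf)).
      apply (Ck_on_ext n U
        (fun p => (-1) * (partial k f p * (/ f p * / f p)))); auto.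
      * intros p Hp; rewrite partial_inv; auto; ring.
      * repeat apply Ck_on_mult; auto; apply Ck_on_const.
Qed.

Lemma open_interior (P : C2 -> Prop) : open (fun p => locally p P).
Proof. intros p; apply locally_locally. Qed.

Lemma smooth_on_sub (U V : C2 -> Prop) f :
  (forall p, V p -> U p) -> smooth_on U f -> smooth_on V f.
Proof. intros S H n; now apply (Ck_on_sub n U). Qed.

Lemma smooth_plus f g : smooth_near_origin f -> smooth_near_origin g ->
  smooth_near_origin (fun p => f p + g p).
Proof.
  intros (U & HU & U0 & Hf) (V & HV & V0 & Hg).
  exists (fun p => U p /\ V p); repeat split; auto.
  - now apply open_and.
  - intros n; apply Ck_on_plus.
    + now apply open_and.
    + apply (smooth_on_sub U); [tauto|exact Hf].
    + apply (smooth_on_sub V); [tauto|exact Hg].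
Qed.

Lemma smooth_mult f g : smooth_near_origin f -> smooth_near_origin g ->
  smooth_near_origin (fun p => f p * g p).
Proof.
  intros (U & HU & U0 & Hf) (V & HV & V0 & Hg).
  exists (fun p => U p /\ V p); repeat split; auto.
  - now apply open_and.
  - intros n; apply Ck_on_mult.
    + now apply open_and.
    + apply (smooth_on_sub U); [tauto|exact Hf].
    + apply (smooth_on_sub V); [tauto|exact Hg].
Qed.

Lemma smooth_const c : smooth_near_origin (fun _ => c).
Proof.
  exists (fun _ => True); repeat split; auto.
  - apply open_true.
  - intros n; apply Ck_on_const.
Qed.

Lemma continuous_near_neq0 (f : C2 -> R) p :
  continuous f p -> f p <> 0 -> locally p (fun q => f q <> 0).
Proof.
  intros Hc H0; apply (Hc (fun x => x <> 0)).
  apply (open_neq 0); auto.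
Qed.

Lemma smooth_continuous_near f : smooth_near_origin f ->
  locally origin (fun p => continuous f p).
Proof.
  intros (U & HU & U0 & Hf); apply (filter_imp U); auto.
  intros p; apply (Hf O).
Qed.

Lemma smooth_continuous f : smooth_near_origin f -> continuous f origin.
Proof. intros H; apply locally_singleton, smooth_continuous_near, H. Qed.

Lemma smooth_inv f : smooth_near_origin f -> f origin <> 0 ->
  smooth_near_origin (fun p => / f p).
Proof.
  intros Hf H0.
  pose proof (continuous_near_neq0 f _ (smooth_continuous f Hf) H0) as Hn.
  destruct Hf as (U & HU & U0 & Hf).
  assert (HV : open (fun p => U p /\ locally p (fun q => f q <> 0)))
    by (apply open_and; auto using open_interior).
  exists (fun p => U p /\ locally p (fun q => f q <> 0));
    repeat split; auto.
  intros n; apply Ck_on_inv; auto.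
  - intros p [_ Hp]; now apply locally_singleton in Hp.
  - apply (smooth_on_sub U); [tauto|exact Hf].
Qed.

Lemma smooth_partial k f : smooth_near_origin f ->
  smooth_near_origin (partial k f).
Proof.
  intros (U & HU & U0 & Hf); exists U; repeat split; auto.
  intros n; apply (Hf (S n)).
Qed.

Lemma smooth_ex_partials f : smooth_near_origin f ->
  locally origin (fun p => forall k, ex_partial k f p).
Proof.
  intros (U & HU & U0 & Hf); apply (filter_imp U); auto.
  intros p Hp k; now apply (Hf 1%nat).
Qed.

Lemma smooth_global f : smooth_on (fun _ => True) f -> smooth_near_origin f.
Proof. intros H; exists (fun _ => True); split; auto using open_true. Qed.

(** * Restriction to a coordinate plane *)

(** The two-dimensional slices on which the two-variable calculus of the
    reals is used; they are affine coordinate planes when [j <> k]. *)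
Definition plane j k (p : C2) (s t : R) : C2 := slice k (slice j p s) t.

Lemma plane_base j k p : plane j k p (coordinate j p) (coordinate k p) = p.
Proof. unfold plane; now rewrite !slice_coordinate. Qed.

Lemma continuous_plane j k p x :
  continuous (fun z : R * R => plane j k p (fst z) (snd z) : C2) x.
Proof.
  destruct x; apply continuous_slice; [apply continuous_slice|].
  - apply continuous_const.
  - apply continuous_fst.
  - apply continuous_snd.
Qed.

Lemma locally_plane j k p (P : C2 -> Prop) : locally p P ->
  locally_2d (fun s t => P (plane j k p s t)) (coordinate j p) (coordinate k p).
Proof.
  intros H; apply locally_2d_locally, continuous_plane; simpl.
  now rewrite plane_base.
Qed.

Lemma slice_plane_fst j k p s t a : j <> k ->
  slice j (plane j k p s t) a = plane j k p a t.
Proof.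
  intros N; unfold plane.
  now rewrite (slice_comm j k), slice_slice, (slice_comm j k).
Qed.

Lemma slice_plane_snd j k p s t a :
  slice k (plane j k p s t) a = plane j k p s a.
Proof. apply slice_slice. Qed.

Lemma partial_plane_fst j k p h s t : j <> k ->
  partial j h (plane j k p s t) = Derive (fun a => h (plane j k p a t)) s.
Proof.
  intros N; unfold partial; replace (coordinate j (plane j k p s t)) with s.
  - apply Derive_ext; intros a; now rewrite slice_plane_fst.
  - unfold plane; now rewrite coordinate_slice_neq, coordinate_slice by auto.
Qed.

Lemma partial_plane_snd j k p h s t :
  partial k h (plane j k p s t) = Derive (fun a => h (plane j k p s a)) t.
Proof.
  unfold partial; replace (coordinate k (plane j k p s t)) with t.
  - apply Derive_ext; intros a; now rewrite slice_plane_snd.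
  - symmetry; apply coordinate_slice.
Qed.

Lemma ex_partial_plane_fst j k p h s t : j <> k ->
  ex_partial j h (plane j k p s t) ->
  ex_derive (fun a => h (plane j k p a t)) s.
Proof.
  intros N; unfold ex_partial; replace (coordinate j (plane j k p s t)) with s.
  - apply ex_derive_ext; intros a; now rewrite slice_plane_fst.
  - unfold plane; now rewrite coordinate_slice_neq, coordinate_slice by auto.
Qed.

Lemma ex_partial_plane_snd j k p h s t :
  ex_partial k h (plane j k p s t) ->
  ex_derive (fun a => h (plane j k p s a)) t.
Proof.
  unfold ex_partial; replace (coordinate k (plane j k p s t)) with t.
  - apply ex_derive_ext; intros a; now rewrite slice_plane_snd.
  - symmetry; apply coordinate_slice.
Qed.

Lemma continuous_on_plane j k p (h : C2 -> R) : continuous h p ->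
  continuity_2d_pt (fun s t => h (plane j k p s t))
    (coordinate j p) (coordinate k p).
Proof.
  intros Hh; apply continuity_2d_pt_filterlim.
  apply (continuous_comp (fun z : R * R => plane j k p (fst z) (snd z)) h).
  - apply continuous_plane.
  - simpl; now rewrite plane_base.
Qed.

(** Along two different coordinates the function restricts to a function of
    two real variables whose iterated derivatives are iterated partials of
    [f], so the classical two-variable theorem applies. *)
Lemma partial_comm j k (f : C2 -> R) (U : C2 -> Prop) p :
  open U -> U p -> Ck_on 2 U f ->
  partial j (partial k f) p = partial k (partial j f) p.
Proof.
  intros HU Hp [_ Hf].
  destruct (coord_eq_dec j k) as [->|N]; [reflexivity|].
  destruct (Hf j) as [Hj [Cj Hj2]], (Hf k) as [Hk [Ck Hk2]].
  pose proof (fun h s t => partial_plane_fst j k p h s t N) as Sj.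
  pose proof (partial_plane_snd j k p) as Sk.
  pose proof (fun h s t => ex_partial_plane_fst j k p h s t N) as Ej.
  pose proof (ex_partial_plane_snd j k p) as Ek.
  rewrite <- (plane_base j k p) at 1 2; rewrite Sj, Sk.
  rewrite (Derive_ext _ _ _ (fun s => Sk f s _)).
  rewrite (Derive_ext _ _ _ (fun t => Sj f _ t)).
  apply (Schwarz (fun s t => f (plane j k p s t))).
  - generalize (locally_plane j k p U (HU p Hp)).
    apply locally_2d_impl, locally_2d_forall; intros s t Hst; repeat split.
    + apply Ej; auto.
    + apply Ek; auto.
    + apply (ex_derive_ext _ _ _ (fun a => Sk f a t)).
      apply Ej; apply Hk2; auto.
    + apply (ex_derive_ext _ _ _ (fun a => Sj f s a)).
      apply Ek; apply Hj2; auto.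
  - apply (continuity_2d_pt_ext
      (fun s t => partial j (partial k f) (plane j k p s t))).
    + intros s t; rewrite Sj; apply Derive_ext; intros a; apply Sk.
    + apply continuous_on_plane; apply Hk2; auto.
  - apply (continuity_2d_pt_ext
      (fun s t => partial k (partial j f) (plane j k p s t))).
    + intros s t; rewrite Sk; apply Derive_ext; intros a; apply Sj.
    + apply continuous_on_plane; apply Hj2; auto.
Qed.

Lemma plane_differentiable j k (f : C2 -> R) (U : C2 -> Prop) p :
  j <> k -> open U -> U p -> Ck_on 1 U f ->
  differentiable_pt_lim (fun s t => f (plane j k p s t))
    (coordinate j p) (coordinate k p) (partial j f p) (partial k f p).
Proof.
  intros N HU Hp [_ Hf].
  destruct (Hf j) as [Ej [Cj _]], (Hf k) as [Ek _].
  apply filterdiff_differentiable_pt_lim.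
  replace (partial j f p)
    with (partial j f (plane j k p (coordinate j p) (coordinate k p)))
    by now rewrite plane_base.
  replace (partial k f p)
    with (partial k f (plane j k p (coordinate j p) (coordinate k p)))
    by now rewrite plane_base.
  apply (is_derive_filterdiff (fun s t => f (plane j k p s t)) _ _
           (fun s t => partial j f (plane j k p s t))).
  - generalize (proj1 (locally_2d_locally _ _ _)
      (locally_plane j k p U (HU p Hp))).
    apply filter_imp; intros [s t] H; simpl in *.
    rewrite partial_plane_fst by auto.
    apply Derive_correct, ex_partial_plane_fst; auto.
  - rewrite partial_plane_snd by auto.
    apply Derive_correct, ex_partial_plane_snd.
    rewrite plane_base; auto.
  - apply (continuous_comp (fun z : R * R => plane j k p (fst z) (snd z))
      (partial j f)); [apply continuous_plane|].
    simpl; rewrite plane_base; auto.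
Qed.

(** * First-order relations on a level set *)

(** Along the level set of [psi] the function [phi] does not change to first
    order.  No smooth parametrization of the level set is constructed: for each
    small step [h] in the first variable, the intermediate value theorem gives
    a zero of [psi] at height [O(h)], because [psi] increases with the second
    variable.  Subtracting the two linear approximations there leaves
    [(a d - c b) h = o(h)]. *)
Lemma level_gradients_2d (phi psi : R -> R -> R) x y a b c d :
  differentiable_pt_lim phi x y a b -> differentiable_pt_lim psi x y c d ->
  0 < d -> phi x y = 0 -> psi x y = 0 ->
  locally_2d (fun s t => continuity_pt (psi s) t) x y ->
  locally_2d (fun s t => psi s t = 0 -> phi s t = 0) x y ->
  a * d = c * b.
Proof.
  intros Dphi Dpsi Hd phi0 psi0 [e1 Hcont] [e2 Hzero].
  destruct (Req_dec (a * d) (c * b)) as [E|N]; [exact E|exfalso].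
  set (gap := Rabs (a * d - c * b)).
  assert (Hgap : 0 < gap) by (apply Rabs_pos_lt; lra).
  (* At height [M * h] above (below) the base point, the term [d * M * h]
     dominates both [c * h] and the error, so [psi] is positive (negative). *)
  set (M := 2 * (Rabs c + 1) / d + 1).
  assert (Hq : d * (M - 1) = 2 * (Rabs c + 1)) by (unfold M; field; lra).
  pose proof (Rabs_pos c) as Hc; pose proof (Rabs_pos b) as Hb.
  assert (HM : 1 <= M).
  { enough (0 < 2 * (Rabs c + 1) / d) by (unfold M; lra).
    apply Rdiv_lt_0_compat; lra. }
  set (B := (d + Rabs b) * M).
  assert (HB : 0 < B) by (apply Rmult_lt_0_compat; lra).
  (* The first bound keeps the sign of [psi] at both ends; the second makes the
     errors too small to account for [gap]. *)
  set (ep := Rmin (d / 2) (gap / (2 * B))).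
  assert (Hep : 0 < ep).
  { apply Rmin_pos; [lra|apply Rdiv_lt_0_compat; lra]. }
  assert (Hep1 : ep <= d / 2) by apply Rmin_l.
  assert (Hep2 : B * ep < gap).
  { apply Rle_lt_trans with (B * (gap / (2 * B))).
    - apply Rmult_le_compat_l; [lra|apply Rmin_r].
    - replace (B * (gap / (2 * B))) with (gap / 2) by (field; lra); lra. }
  destruct (Dphi (mkposreal ep Hep)) as [e3 Aphi].
  destruct (Dpsi (mkposreal ep Hep)) as [e4 Apsi]; simpl in Aphi, Apsi.
  set (e := Rmin (Rmin e1 e2) (Rmin e3 e4)).
  assert (He : 0 < e) by (repeat apply Rmin_pos; apply cond_pos).
  assert (e <= e1 /\ e <= e2 /\ e <= e3 /\ e <= e4) as (L1 & L2 & L3 & L4).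
  { unfold e; repeat split.
    - eapply Rle_trans; [apply Rmin_l|apply Rmin_l].
    - eapply Rle_trans; [apply Rmin_l|apply Rmin_r].
    - eapply Rle_trans; [apply Rmin_r|apply Rmin_l].
    - eapply Rle_trans; [apply Rmin_r|apply Rmin_r]. }
  set (h := e / (2 * M)).
  assert (Hh : 0 < h) by (apply Rdiv_lt_0_compat; lra).
  assert (HMh : M * h = e / 2) by (unfold h; field; lra).
  assert (Hhe : h < e) by nra.
  assert (Hx : Rabs (x + h - x) = h)
    by (replace (x + h - x) with h by ring; apply Rabs_pos_eq; lra).
  assert (est : forall t, Rabs (t - y) <= M * h ->
     Rabs (psi (x + h) t - (c * h + d * (t - y))) <= ep * (M * h) /\
     Rabs (phi (x + h) t - (a * h + b * (t - y))) <= ep * (M * h)).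
  { intros t Ht.
    assert (Hmax : Rmax (Rabs (x + h - x)) (Rabs (t - y)) <= M * h)
      by (apply Rmax_lub; [rewrite Hx; nra|exact Ht]).
    specialize (Aphi (x + h) t); specialize (Apsi (x + h) t).
    rewrite phi0 in Aphi; rewrite psi0 in Apsi; split.
    - replace (psi (x + h) t - (c * h + d * (t - y))) with
       (psi (x + h) t - 0 - (c * (x + h - x) + d * (t - y))) by ring.
      eapply Rle_trans; [apply Apsi; lra|].
      apply Rmult_le_compat_l; lra.
    - replace (phi (x + h) t - (a * h + b * (t - y))) with
       (phi (x + h) t - 0 - (a * (x + h - x) + b * (t - y))) by ring.
      eapply Rle_trans; [apply Aphi; lra|].
      apply Rmult_le_compat_l; lra. }
  pose proof (Rle_abs c) as Hc1; pose proof (Rle_abs (- c)) as Hc2.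
  rewrite Rabs_Ropp in Hc2.
  assert (Hpos : 0 < psi (x + h) (y + M * h)).
  { destruct (est (y + M * h)) as [H _].
    - replace (y + M * h - y) with (M * h) by ring; rewrite Rabs_pos_eq; nra.
    - apply Rabs_le_between in H; nra. }
  assert (Hneg : psi (x + h) (y - M * h) < 0).
  { destruct (est (y - M * h)) as [H _].
    - replace (y - M * h - y) with (- (M * h)) by ring.
      rewrite Rabs_Ropp, Rabs_pos_eq; nra.
    - apply Rabs_le_between in H; nra. }
  destruct (Ranalysis5.IVT_interv (psi (x + h)) (y - M * h) (y + M * h))
    as [t [Ht Zt]]; try assumption.
  { intros t Ht; apply Hcont; [lra|].
    apply Rle_lt_trans with (M * h); [apply Rabs_le_between; lra|lra]. }
  { nra. }
  assert (Ht' : Rabs (t - y) <= M * h) by (apply Rabs_le_between; lra).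
  assert (Zphi : phi (x + h) t = 0) by (apply Hzero; [lra|lra|exact Zt]).
  destruct (est t Ht') as [E1 E2]; rewrite Zt in E1; rewrite Zphi in E2.
  assert (K : gap * h <= B * ep * h).
  { unfold gap; rewrite <- (Rabs_pos_eq h) at 1; [|lra].
    rewrite <- Rabs_mult.
    replace ((a * d - c * b) * h) with
      (b * (0 - (c * h + d * (t - y))) + - d * (0 - (a * h + b * (t - y))))
      by ring.
    eapply Rle_trans; [apply Rabs_triang|].
    rewrite !Rabs_mult, Rabs_Ropp, (Rabs_pos_eq d) by lra.
    apply Rle_trans with
      (Rabs b * (ep * (M * h)) + d * (ep * (M * h))).
    - apply Rplus_le_compat; apply Rmult_le_compat_l; lra.
    - unfold B; right; ring. }
  nra.
Qed.

(** Only the two-dimensional slice in the directions of [k] and of the last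
    coordinate matters, so [level_gradients_2d] applies. *)
Lemma level_set_gradient (U : C2 -> Prop) (f r : C2 -> R) p k :
  open U -> U p -> Ck_on 1 U f -> Ck_on 1 U r ->
  0 < partial cv r p -> r p = 0 ->
  (forall q, U q -> r q = 0 -> f q = 0) ->
  partial k f p * partial cv r p = partial k r p * partial cv f p.
Proof.
  intros HU Hp Hf Hr Hd r0 Hz.
  destruct (coord_eq_dec k cv) as [->|N]; [ring|].
  pose proof (locally_plane k cv p U (HU p Hp)) as L.
  apply (level_gradients_2d (fun s t => f (plane k cv p s t))
    (fun s t => r (plane k cv p s t)) (coordinate k p) (coordinate cv p)).
  - now apply (plane_differentiable k cv f U).
  - now apply (plane_differentiable k cv r U).
  - exact Hd.
  - rewrite plane_base; auto.
  - now rewrite plane_base.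
  - revert L; apply locally_2d_impl, locally_2d_forall; intros s t H.
    apply continuity_pt_filterlim.
    apply (continuous_comp (fun t => plane k cv p s t) r).
    + apply continuous_slice_line.
    + now apply Hr.
  - revert L; apply locally_2d_impl, locally_2d_forall; intros s t H.
    now apply Hz.
Qed.

(** * Wirtinger derivatives of real functions in real coordinates *)

Lemma Cpartial_toC k f p : Cpartial k (toC f) p = (partial k f p, 0).
Proof. unfold Cpartial; f_equal; apply (partial_const k 0). Qed.

Ltac Cexpand := unfold toC, RtoC, Cdiv, Cinv, Cminus, Cplus, Cmult, Copp,
  Cconj, Ci, Re, Im in *; simpl fst in *; simpl snd in *.

Lemma d_z_toC f p : d_z (toC f) p = (/2 * partial cx f p, - / 2 * partial cy f p).
Proof.
  unfold d_z; rewrite !Cpartial_toC; Cexpand; f_equal; field.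
Qed.

Lemma d_w_toC f p : d_w (toC f) p = (/2 * partial cu f p, - / 2 * partial cv f p).
Proof.
  unfold d_w; rewrite !Cpartial_toC; Cexpand; f_equal; field.
Qed.

Lemma d_zbar_toC f p :
  d_zbar (toC f) p = (/2 * partial cx f p, / 2 * partial cy f p).
Proof.
  unfold d_zbar; rewrite !Cpartial_toC; Cexpand; f_equal; field.
Qed.

Lemma d_wbar_toC f p :
  d_wbar (toC f) p = (/2 * partial cu f p, / 2 * partial cv f p).
Proof.
  unfold d_wbar; rewrite !Cpartial_toC; Cexpand; f_equal; field.
Qed.

Lemma d_zbar_conj f p : d_zbar (toC f) p = Cconj (d_z (toC f) p).
Proof. rewrite d_zbar_toC, d_z_toC; Cexpand; f_equal; ring. Qed.

Lemma d_wbar_conj f p : d_wbar (toC f) p = Cconj (d_w (toC f) p).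
Proof. rewrite d_wbar_toC, d_w_toC; Cexpand; f_equal; ring. Qed.

Lemma Cpartial_scal_pair k c (a b : C2 -> R) p :
  Cpartial k (fun q => (c * a q, c * b q)) p
  = (c * partial k a p, c * partial k b p).
Proof. unfold Cpartial; f_equal; apply partial_scal. Qed.

Ltac second_order L1 :=
  rewrite (functional_extensionality _ _ (L1 _)), !Cpartial_scal_pair;
  Cexpand; f_equal; field.

Lemma d_z_d_zbar_toC f p : d_z (d_zbar (toC f)) p =
  (/4 * (partial cx (partial cx f) p + partial cy (partial cy f) p),
   /4 * (partial cx (partial cy f) p - partial cy (partial cx f) p)).
Proof. unfold d_z; second_order d_zbar_toC. Qed.

Lemma d_z_d_wbar_toC f p : d_z (d_wbar (toC f)) p =
  (/4 * (partial cx (partial cu f) p + partial cy (partial cv f) p),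
   /4 * (partial cx (partial cv f) p - partial cy (partial cu f) p)).
Proof. unfold d_z; second_order d_wbar_toC. Qed.

Lemma d_w_d_zbar_toC f p : d_w (d_zbar (toC f)) p =
  (/4 * (partial cu (partial cx f) p + partial cv (partial cy f) p),
   /4 * (partial cu (partial cy f) p - partial cv (partial cx f) p)).
Proof. unfold d_w; second_order d_zbar_toC. Qed.

Lemma d_w_d_wbar_toC f p : d_w (d_wbar (toC f)) p =
  (/4 * (partial cu (partial cu f) p + partial cv (partial cv f) p),
   /4 * (partial cu (partial cv f) p - partial cv (partial cu f) p)).
Proof. unfold d_w; second_order d_wbar_toC. Qed.

(** * Hermitian forms in two variables *)

Lemma Cmod_sq c : Cmod c ^ 2 = Re c ^ 2 + Im c ^ 2.
Proof.
  unfold Cmod; rewrite pow2_sqrt; [reflexivity|].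
  pose proof (pow2_ge_0 (fst c)); pose proof (pow2_ge_0 (snd c)); lra.
Qed.

Lemma Cmod_sq_minus x y :
  Cmod (x - y) ^ 2 <= 2 * Cmod x ^ 2 + 2 * Cmod y ^ 2.
Proof.
  rewrite !Cmod_sq; destruct x, y; Cexpand.
  pose proof (pow2_ge_0 (r + r1)); pose proof (pow2_ge_0 (r0 + r2)); lra.
Qed.

(** The Hermitian form with matrix rows [(a, b)] and [(Cconj b, d)]. *)
Definition herm (a : R) (b : C) (d : R) (s t : C) : R :=
  a * Cmod s ^ 2 + 2 * Re (b * s * Cconj t)%C + d * Cmod t ^ 2.

Ltac Cring := unfold herm; rewrite ?Cmod_sq; Cexpand; ring.

(** The change of frame [Q (s, t) = s (Q, -P) + (Q t + s P) (0, 1)].  When [P]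
    and [Q] are the two components of the complex gradient of [r], the vector
    [(Q, -P)] spans the complex tangent space of the level set. *)
Lemma herm_frame (P Q : C) a b d s t :
  Cmod Q ^ 2 * herm a b d s t
  = herm (herm a b d Q (- P)) (Q * b - P * d)%C d s (Q * t + s * P)%C.
Proof.
  destruct P, Q, b, s, t; Cring.
Qed.

(** The cross term is at most [2 sqrt (u v) <= u + v], where [u] and [v] are
    the diagonal terms. *)
Lemma herm_nonneg a b d s t : 0 <= a -> 0 <= d -> Cmod b ^ 2 <= a * d ->
  0 <= herm a b d s t.
Proof.
  intros Ha Hd Hb; unfold herm.
  set (m := Re (b * s * Cconj t)%C).
  set (u := a * Cmod s ^ 2); set (v := d * Cmod t ^ 2).
  assert (Hu : 0 <= u) by (apply Rmult_le_pos; [lra|apply pow2_ge_0]).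
  assert (Hv : 0 <= v) by (apply Rmult_le_pos; [lra|apply pow2_ge_0]).
  assert (Hm : m ^ 2 <= u * v).
  { apply Rle_trans with (Cmod (b * s * Cconj t) ^ 2).
    - rewrite Cmod_sq; fold m; pose proof (pow2_ge_0 (Im (b * s * Cconj t)));
      lra.
    - rewrite !Cmod_mult, Cmod_conj, !Rpow_mult_distr.
      apply Rle_trans with (a * d * (Cmod s ^ 2 * Cmod t ^ 2));
        [|unfold u, v; right; ring].
      rewrite Rmult_assoc; apply Rmult_le_compat_r; [|exact Hb].
      apply Rmult_le_pos; apply pow2_ge_0. }
  clearbody u v m; apply Rnot_lt_le; intros Hneg.
  assert (0 < (- (2 * m) - (u + v)) * (- (2 * m) + (u + v)))
    by (apply Rmult_lt_0_compat; lra).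
  pose proof (pow2_ge_0 (u - v)); lra.
Qed.

(** The test vector [(M, -b)], with a bound [M] in the place of [d], gives the
    determinant inequality without a separate case for [d = 0]. *)
Lemma herm_offdiag_bound a b d M : (forall s t, 0 <= herm a b d s t) ->
  0 < M -> d <= M -> Cmod b ^ 2 <= M * a.
Proof.
  intros H HM Hd.
  pose proof (H (RtoC M) (- b)%C) as Hb.
  replace (herm a b d (RtoC M) (- b)%C)
    with (M * (M * a) - (2 * M - d) * Cmod b ^ 2) in Hb
    by (destruct b; Cring).
  pose proof (pow2_ge_0 (Cmod b)).
  apply Rmult_le_reg_l with M; nra.
Qed.

(** The vector [(Q, 0)] is the sum of the tangent [(Q, -P)] and [(0, P)]; the
    form is nonnegative on their difference, which is the test vector. *)
Lemma herm_diag_bound a b d (P Q : C) : (forall s t, 0 <= herm a b d s t) ->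
  a * Cmod Q ^ 2 <= 2 * herm a b d Q (- P)%C + 2 * d * Cmod P ^ 2.
Proof.
  intros H; pose proof (H Q (- (2 * P))%C) as Hb.
  replace (herm a b d Q (- (2 * P))%C)
    with (2 * herm a b d Q (- P)%C + 2 * d * Cmod P ^ 2 - a * Cmod Q ^ 2) in Hb
    by (destruct b, P, Q; Cring).
  lra.
Qed.

(** * The complex Hessian as a Hermitian form *)

Definition mixed_symmetric (f : C2 -> R) p :=
  forall j k, partial j (partial k f) p = partial k (partial j f) p.

Lemma Re_hessian_form f p s t : mixed_symmetric f p ->
  Re (hessian_form f p s t)
  = herm (Re (d_z (d_zbar (toC f)) p)) (d_z (d_wbar (toC f)) p)
         (Re (d_w (d_wbar (toC f)) p)) s t.
Proof.
  intros H; unfold hessian_form.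
  rewrite d_w_d_zbar_toC, d_z_d_zbar_toC, d_z_d_wbar_toC, d_w_d_wbar_toC.
  rewrite (H cu cx), (H cv cy), (H cu cy), (H cv cx), (H cx cy), (H cv cu).
  destruct s, t; Cring.
Qed.

Lemma levi_herm r p :
  levi r p = herm (Re (d_z (d_zbar (toC r)) p)) (d_z (d_wbar (toC r)) p)
    (Re (d_w (d_wbar (toC r)) p)) (d_w (toC r) p) (- d_z (toC r) p)%C.
Proof.
  unfold levi; rewrite d_zbar_conj.
  generalize (Re (d_z (d_zbar (toC r)) p)), (d_z (d_wbar (toC r)) p),
    (Re (d_w (d_wbar (toC r)) p)), (d_w (toC r) p), (d_z (toC r) p).
  intros a [] d [] []; Cring.
Qed.

(** * Second derivatives of functions with the same zero set *)

(** What Leibniz's rule gives for the second derivatives of a multiple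
    [(g + (m/2) r) r] of [r] at a zero of [r]. Writing the relation with [g] and
    [m] lets it hold for any [rho] with the same zeros as [r], without dividing
    [rho] by [r]. *)
Definition second_order_multiple (rho r g : C2 -> R) (m : R) (p : C2) :=
  forall j k, partial j (partial k rho) p
    = g p * partial j (partial k r) p
      + partial j g p * partial k r p + partial k g p * partial j r p
      + m * (partial j r p * partial k r p).

Lemma hessian_multiple rho r g m p : second_order_multiple rho r g m p ->
  Re (d_z (d_zbar (toC rho)) p)
    = g p * Re (d_z (d_zbar (toC r)) p)
      + 2 * Re (d_z (toC g) p * Cconj (d_z (toC r) p))%C
      + m * Cmod (d_z (toC r) p) ^ 2 /\
  d_z (d_wbar (toC rho)) p
    = (g p * d_z (d_wbar (toC r)) p
       + d_z (toC g) p * Cconj (d_w (toC r) p)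
       + Cconj (d_w (toC g) p) * d_z (toC r) p
       + m * d_z (toC r) p * Cconj (d_w (toC r) p))%C /\
  Re (d_w (d_wbar (toC rho)) p)
    = g p * Re (d_w (d_wbar (toC r)) p)
      + 2 * Re (d_w (toC g) p * Cconj (d_w (toC r) p))%C
      + m * Cmod (d_w (toC r) p) ^ 2.
Proof.
  intros H; rewrite !d_z_d_zbar_toC, !d_z_d_wbar_toC, !d_w_d_wbar_toC.
  rewrite !d_z_toC, !d_w_toC, !Cmod_sq, !H; Cexpand.
  repeat split; [field|f_equal; field|field].
Qed.

(** Each gradient term contains [P Q - Q P = 0], or its conjugate, as a factor on
    the vector [(Q, -P)], so only the Hessian multiplied by [g] survives. *)
Lemma herm_tangent_multiple (g m : R) (P Q G H B : C) (A D : R) :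
  herm (g * A + 2 * Re (G * Cconj P)%C + m * Cmod P ^ 2)
    (g * B + G * Cconj Q + Cconj H * P + m * P * Cconj Q)%C
    (g * D + 2 * Re (H * Cconj Q)%C + m * Cmod Q ^ 2) Q (- P)%C
  = g * herm A B D Q (- P)%C.
Proof. destruct P, Q, G, H, B; Cring. Qed.

Lemma product_second_order (h r : C2 -> R) (U : C2 -> Prop) p :
  open U -> smooth_on U h -> smooth_on U r -> U p -> r p = 0 ->
  second_order_multiple (fun q => h q * r q) r h 0 p.
Proof.
  intros HU Hh Hr Hp r0 j k.
  assert (Ph : forall i q, U q -> ex_partial i h q)
    by (intros i q; apply (Hh 1%nat)).
  assert (Pr : forall i q, U q -> ex_partial i r q)
    by (intros i q; apply (Hr 1%nat)).
  assert (Ph2 : ex_partial j (partial k h) p)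
    by (destruct (Hh 2%nat) as [_ H]; now apply H).
  assert (Pr2 : ex_partial j (partial k r) p)
    by (destruct (Hr 2%nat) as [_ H]; now apply H).
  rewrite (partial_ext_loc j _ (fun q => partial k h q * r q + h q * partial k r q)).
  - rewrite partial_plus, !partial_mult by auto using ex_partial_mult.
    rewrite r0; ring.
  - apply (filter_imp U); auto; intros q Hq; apply partial_mult; auto.
Qed.

(** The gradient of [rho] equals [g] times that of [r] on the zero set, so
    each [G_k = rho_k - g r_k] vanishes there and has in its turn a gradient
    proportional to that of [r].  The proportionality factor is found from the
    derivative in the last coordinate: as [rho_v = g r_v] holds on an open set,
    symmetry of mixed derivatives gives [(G_k)_v = g_k r_v - g_v r_k]. *)
Lemma zero_set_second_order (rho r : C2 -> R) (U : C2 -> Prop) p :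
  let g := fun q => partial cv rho q * / partial cv r q in
  open U -> smooth_on U rho -> smooth_on U r -> smooth_on U g ->
  (forall q, U q -> 0 < partial cv r q) ->
  (forall q, U q -> r q = 0 -> rho q = 0) ->
  U p -> r p = 0 ->
  (forall k, partial k rho p = g p * partial k r p) /\
  second_order_multiple rho r g (- (partial cv g p * / partial cv r p)) p.
Proof.
  intros g HU Hrho Hr Hg Hpos Hz Hp r0.
  assert (first : forall k q, U q -> r q = 0 ->
                    partial k rho q = g q * partial k r q).
  { intros k q Hq rq.
    pose proof (level_set_gradient U rho r q k HU Hq (Hrho 1%nat) (Hr 1%nat)
                  (Hpos q Hq) rq Hz) as E.
    pose proof (Hpos q Hq); unfold g.
    apply Rmult_eq_reg_r with (partial cv r q); [|lra].
    rewrite E; field; lra. }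
  split; [intros k; now apply first|intros j k].
  assert (Pg : forall i q, U q -> ex_partial i g q)
    by (intros i q; apply (Hg 1%nat)).
  assert (Prho2 : forall i l q, U q -> ex_partial i (partial l rho) q)
    by (intros i l q; destruct (Hrho 2%nat) as [_ H]; apply H).
  assert (Pr2 : forall i l q, U q -> ex_partial i (partial l r) q)
    by (intros i l q; destruct (Hr 2%nat) as [_ H]; apply H).
  set (G := fun q => partial k rho q + (-1) * (g q * partial k r q)).
  assert (PG : forall i, partial i G p = partial i (partial k rho) p
     - (partial i g p * partial k r p + g p * partial i (partial k r) p)).
  { intros i; unfold G.
    rewrite partial_plus, partial_scal, partial_mult; auto; [ring|].
    apply ex_partial_mult; auto using ex_partial_const, ex_partial_mult. }
  pose proof (level_set_gradient U G r p j HU Hp) as E.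
  rewrite !PG in E.
  assert (Vk : partial cv (partial k rho) p
    = partial k g p * partial cv r p + g p * partial cv (partial k r) p).
  { rewrite !(partial_comm cv k _ U p HU Hp) by auto.
    rewrite (partial_ext_loc k _ (fun q => g q * partial cv r q)).
    - apply partial_mult; auto.
    - apply (filter_imp U); auto; intros q Hq; unfold g.
      pose proof (Hpos q Hq); field; lra. }
  rewrite Vk in E.
  pose proof (Hpos p Hp) as Hv.
  apply Rmult_eq_reg_r with (partial cv r p); [|lra].
  assert (CG : Ck_on 1 U G).
  { apply Ck_on_plus; auto.
    - apply (Hrho 2%nat).
    - apply Ck_on_mult; auto using Ck_on_const.
      apply Ck_on_mult; auto; apply (Hr 2%nat). }
  assert (ZG : forall q, U q -> r q = 0 -> G q = 0).
  { intros q Hq rq; unfold G; rewrite (first k q Hq rq); ring. }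
  specialize (E CG (Hr 1%nat) Hv r0 ZG).
  field_simplify; [|lra]; field_simplify in E; lra.
Qed.

Lemma d_wbar_neq0 r p : 0 < partial cv r p ->
  d_wbar (toC r) p <> RtoC 0.
Proof.
  rewrite d_wbar_toC; intros H E; apply (f_equal snd) in E; simpl in E; lra.
Qed.

Lemma d_w_sq_pos r p : 0 < partial cv r p -> 0 < Cmod (d_w (toC r) p) ^ 2.
Proof.
  intros H; apply pow_lt, Cmod_gt_0; rewrite d_w_toC.
  intros E; apply (f_equal snd) in E; simpl in E; lra.
Qed.

(** * Smooth complex functions and local bounds *)

Lemma smooth_ext f g : (forall p, f p = g p) ->
  smooth_near_origin f -> smooth_near_origin g.
Proof. intros E; now rewrite (functional_extensionality _ _ E). Qed.

Lemma smooth_scal c f : smooth_near_origin f ->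
  smooth_near_origin (fun p => c * f p).
Proof. intros H; apply smooth_mult; auto using smooth_const. Qed.

Lemma Csmooth_plus g h : Csmooth_near_origin g -> Csmooth_near_origin h ->
  Csmooth_near_origin (fun p => g p + h p)%C.
Proof. intros [] []; split; now apply smooth_plus. Qed.

Lemma Csmooth_mult g h : Csmooth_near_origin g -> Csmooth_near_origin h ->
  Csmooth_near_origin (fun p => g p * h p)%C.
Proof.
  intros [g1 g2] [h1 h2]; split.
  - apply (smooth_ext (fun p => Re (g p) * Re (h p) + (-1) * (Im (g p) * Im (h p)))).
    { intros p; Cexpand; ring. }
    auto using smooth_plus, smooth_mult, smooth_scal.
  - apply (smooth_ext (fun p => Re (g p) * Im (h p) + Im (g p) * Re (h p))).
    { intros p; Cexpand; ring. }
    auto using smooth_plus, smooth_mult.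
Qed.

Lemma Csmooth_const c : Csmooth_near_origin (fun _ => c).
Proof. split; apply smooth_const. Qed.

Lemma Csmooth_toC f : smooth_near_origin f -> Csmooth_near_origin (toC f).
Proof. intros H; split; [exact H|apply (smooth_const 0)]. Qed.

Lemma Csmooth_Cpartial k g : Csmooth_near_origin g ->
  Csmooth_near_origin (Cpartial k g).
Proof.
  intros [H1 H2]; split.
  - exact (smooth_partial k _ H1).
  - exact (smooth_partial k _ H2).
Qed.

Lemma Csmooth_opp g : Csmooth_near_origin g ->
  Csmooth_near_origin (fun p => - g p)%C.
Proof.
  intros H; replace (fun p => - g p)%C with (fun p => (- (1)) * g p)%C
    by (apply functional_extensionality; intros p; ring).
  auto using Csmooth_mult, Csmooth_const.
Qed.

Lemma Csmooth_conj g : Csmooth_near_origin g ->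
  Csmooth_near_origin (fun p => Cconj (g p)).
Proof.
  intros [H1 H2]; split; [exact H1|].
  apply (smooth_ext (fun p => (-1) * Im (g p))); auto using smooth_scal.
  intros p; Cexpand; ring.
Qed.

Lemma Csmooth_inv g : Csmooth_near_origin g -> g origin <> RtoC 0 ->
  Csmooth_near_origin (fun p => / g p)%C.
Proof.
  intros [H1 H2] H0.
  assert (Hi : smooth_near_origin (fun p => / (Re (g p) ^ 2 + Im (g p) ^ 2))).
  { apply smooth_inv.
    - simpl; apply smooth_plus; auto using smooth_mult, smooth_const.
    - rewrite <- Cmod_sq; apply pow_nonzero.
      intros E; apply H0, Cmod_eq_0, E. }
  split.
  - apply smooth_mult; auto.
  - apply (smooth_ext (fun p =>
      (-1) * Im (g p) * / (Re (g p) ^ 2 + Im (g p) ^ 2))).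
    { intros p; unfold Cinv, Rdiv, Re, Im; cbn -[pow]; ring. }
    auto using smooth_mult, smooth_scal.
Qed.

Lemma Csmooth_wirtinger g : Csmooth_near_origin g ->
  Csmooth_near_origin (d_z g) /\ Csmooth_near_origin (d_zbar g) /\
  Csmooth_near_origin (d_w g) /\ Csmooth_near_origin (d_wbar g).
Proof.
  intros H; split; [|split; [|split]];
  (apply (Csmooth_mult (fun p => Cpartial _ g p + _)%C (fun _ => / 2)%C);
   [apply Csmooth_plus|]);
  auto using Csmooth_opp, Csmooth_mult, Csmooth_const, Csmooth_Cpartial.
Qed.

Lemma smooth_bounded_above f : smooth_near_origin f ->
  exists M, 0 < M /\ locally origin (fun p => f p <= M).
Proof.
  intros Hf; exists (Rabs (f origin) + 1); split.
  - pose proof (Rabs_pos (f origin)); lra.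
  - pose proof (smooth_continuous f Hf
      (fun x => x < Rabs (f origin) + 1)) as H.
    apply (filter_imp (fun p => f p < Rabs (f origin) + 1)); [intros; lra|].
    apply H, (open_lt (Rabs (f origin) + 1)).
    pose proof (Rle_abs (f origin)); lra.
Qed.

Lemma Csmooth_sq g : Csmooth_near_origin g ->
  smooth_near_origin (fun p => Cmod (g p) ^ 2).
Proof.
  intros [H1 H2].
  apply (smooth_ext (fun p => Re (g p) * Re (g p) + Im (g p) * Im (g p))).
  - intros p; rewrite Cmod_sq; ring.
  - auto using smooth_plus, smooth_mult.
Qed.

Lemma greater_near (f : C2 -> R) p c : continuous f p -> c < f p ->
  locally p (fun q => c < f q).
Proof. intros Hf Hc; apply (Hf (fun x => c < x)), (open_gt c), Hc. Qed.

Lemma smooth_mixed_symmetric f : smooth_near_origin f ->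
  locally origin (mixed_symmetric f).
Proof.
  intros (U & HU & U0 & Hf); apply (filter_imp U); auto.
  intros p Hp j k; apply (partial_comm j k f U); auto.
Qed.

(** * Zero sets and boundaries *)

Lemma locally_left (x : R) P : locally x P -> exists t, t < x /\ P t.
Proof.
  intros [e He]; exists (x - e / 2); pose proof (cond_pos e); split; [lra|].
  apply He; change (Rabs ((x - e / 2) - x) < e).
  rewrite Rabs_left; lra.
Qed.

Lemma negative_on_left (f : R -> R) (x : R) :
  ex_derive f x -> f x = 0 -> 0 < Derive f x ->
  locally x (fun t => t < x -> f t < 0).
Proof.
  intros Hf f0 Hd.
  pose proof (proj1 (is_derive_Reals _ _ _) (Derive_correct _ _ Hf)) as D.
  destruct (D _ Hd) as [e He]; exists e; intros t Ht Hlt.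
  change (Rabs (t - x) < e) in Ht.
  assert (Hq := He (t - x) ltac:(lra) Ht).
  rewrite Rplus_minus, f0 in Hq.
  apply Rabs_lt_between in Hq.
  set (q := (f t - 0) / (t - x)) in Hq.
  assert (E : f t = q * (t - x)) by (unfold q; field; lra).
  nra.
Qed.

Lemma boundary_zero (Om : C2 -> Prop) (r : C2 -> R) p : (forall q, continuous r q) ->
  (forall q, Om q <-> r q < 0) -> boundary Om p -> r p = 0.
Proof.
  intros Hc HOm Hb.
  destruct (Rtotal_order (r p) 0) as [H|[H|H]]; [exfalso| assumption|exfalso].
  - destruct (Hb (fun q => r q < 0)) as [_ [q [H1 H2]]].
    + apply (Hc p (fun x => x < 0)), (open_lt 0), H.
    + now apply H2, HOm.
  - destruct (Hb (fun q => 0 < r q)) as [[q [H1 H2]] _].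
    + apply (Hc p (fun x => 0 < x)), (open_gt 0), H.
    + apply HOm in H2; lra.
Qed.

(** Lowering the last coordinate from a zero of [r] enters the region
    [r < 0], where [rho < 0] as well; so [rho] is not positive at the zero, and
    it is not negative because [r] is not. *)
Lemma same_sign_same_zeros (V : C2 -> Prop) (rho r : C2 -> R) p :
  open V -> V p -> (forall q, V q -> (r q < 0 <-> rho q < 0)) ->
  continuous rho p -> ex_partial cv r p -> 0 < partial cv r p ->
  r p = 0 -> rho p = 0.
Proof.
  intros HV Vp HVs Hc Hex Hpos r0.
  apply Rle_antisym; apply Rnot_lt_le; intros H.
  - assert (N := negative_on_left _ _ Hex).
    cbv beta in N; rewrite slice_coordinate in N; specialize (N r0 Hpos).
    assert (L : locally p (fun q => V q /\ 0 < rho q))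
      by (apply filter_and; [now apply HV|now apply greater_near]).
    destruct (locally_left _ _ (filter_and _ _ N (locally_slice cv p _ L)))
      as (t & Ht & Hr & HVt & Hrho).
    apply HVs in HVt; specialize (Hr Ht); lra.
  - apply HVs in H; auto; lra.
Qed.

Lemma same_sign_gradient (V : C2 -> Prop) (rho r : C2 -> R) p :
  open V -> V p -> (forall q, V q -> (r q < 0 <-> rho q < 0)) ->
  ex_partial cv rho p -> ex_partial cv r p -> 0 < partial cv r p ->
  r p = 0 -> rho p = 0 -> 0 <= partial cv rho p.
Proof.
  intros HV Vp HVs Hexr Hex Hpos r0 rho0; apply Rnot_lt_le; intros H.
  assert (N := negative_on_left _ _ Hex).
  cbv beta in N; rewrite slice_coordinate in N; specialize (N r0 Hpos).
  assert (N' := negative_on_left (fun t => -1 * rho (slice cv p t))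
     (coordinate cv p)).
  rewrite Derive_scal, slice_coordinate, rho0 in N'.
  fold (partial cv rho p) in N'.
  specialize (N' (ex_derive_scal _ _ _ Hexr) (Rmult_0_r _) ltac:(lra)).
  destruct (locally_left _ _ (filter_and _ _ N (filter_and _ _ N'
    (locally_slice cv p _ (HV p Vp))))) as (t & Ht & Hr & Hrho & HVt).
  apply HVs in HVt; specialize (Hr Ht); specialize (Hrho Ht); lra.
Qed.

(** * The two pointwise estimates *)

(** In the frame of [herm_frame] the diagonal entries are [g L] and
    [d >= 2 K q0 - D1], and the off-diagonal entry is
    [g |Q|^2 E - P (g D + H Cconj Q)]: the terms with [K] cancel in it.  Since
    [|E|^2] and [|P|^2] are both controlled by [L], its square is at most a
    constant times [L], and a large [K] makes the determinant nonnegative. *)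
Lemma psh_from_factor (P Q G H B E : C) (A D g K : R)
  (C0 C1 g0 q0 N S D1 : R) :
  let L := herm A B D Q (- P)%C in
  (g * B + G * Cconj Q = g * Cconj Q * E)%C ->
  0 < C0 -> 0 < C1 -> 0 < g0 -> 0 < q0 -> 0 < K -> 0 < N -> 0 < S ->
  Cmod P ^ 2 <= C0 * L -> Cmod E ^ 2 <= C1 * (L + Cmod P ^ 2) ->
  g0 <= g -> q0 <= Cmod Q ^ 2 -> (g * Cmod Q ^ 2) ^ 2 <= N ->
  Cmod (g * D + H * Cconj Q)%C ^ 2 <= S ->
  - (g * D + 2 * Re (H * Cconj Q)%C) <= D1 ->
  2 * N * C1 * (1 + C0) + 2 * S * C0 <= g0 * (2 * K * q0 - D1) ->
  forall s t, 0 <= herm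
    (g * A + 2 * Re (G * Cconj P)%C + 2 * K * Cmod P ^ 2)
    (g * B + G * Cconj Q + Cconj H * P + (2 * K)%R * P * Cconj Q)%C
    (g * D + 2 * Re (H * Cconj Q)%C + 2 * K * Cmod Q ^ 2) s t.
Proof.
  intros L HE HC0 HC1 Hg0 Hq0 HK HN HS HP HEb Hg Hq HNb HSb HD1 HKb s t.
  apply Rmult_le_reg_l with (Cmod Q ^ 2); [lra|]; rewrite Rmult_0_r.
  rewrite (herm_frame P Q), herm_tangent_multiple; fold L.
  set (d := g * D + 2 * Re (H * Cconj Q)%C + 2 * K * Cmod Q ^ 2).
  assert (HL : 0 <= L).
  { pose proof (pow2_ge_0 (Cmod P)).
    apply Rmult_le_reg_l with C0; lra. }
  assert (Hd : 2 * K * q0 - D1 <= d).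
  { assert (2 * K * q0 <= 2 * K * Cmod Q ^ 2)
      by (apply Rmult_le_compat_l; lra).
    unfold d; lra. }
  assert (HM : 0 < 2 * N * C1 * (1 + C0) + 2 * S * C0).
  { assert (0 < N * C1) by (apply Rmult_lt_0_compat; lra).
    assert (0 < N * C1 * C0) by (apply Rmult_lt_0_compat; lra).
    assert (0 < S * C0) by (apply Rmult_lt_0_compat; lra).
    lra. }
  assert (Hd0 : 0 < 2 * K * q0 - D1).
  { apply Rmult_lt_reg_l with g0; lra. }
  set (c := (RtoC (g * Cmod Q ^ 2) * E - P * (g * D + H * Cconj Q))%C).
  assert (Ec : (Q * (g * B + G * Cconj Q + Cconj H * P
                     + (2 * K)%R * P * Cconj Q) - P * d)%C = c).
  { rewrite HE; unfold c, d; rewrite !Cmod_sq.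
    destruct P, Q, H, E; Cexpand; f_equal; ring. }
  rewrite Ec.
  assert (Hc : Cmod c ^ 2 <= (2 * N * C1 * (1 + C0) + 2 * S * C0) * L).
  { eapply Rle_trans; [apply Cmod_sq_minus|].
    rewrite !Cmod_mult, !Rpow_mult_distr, Cmod_R, pow2_abs.
    pose proof (pow2_ge_0 (Cmod E)); pose proof (pow2_ge_0 (Cmod P)).
    assert ((g * Cmod Q ^ 2) ^ 2 * Cmod E ^ 2 <= N * (C1 * ((1 + C0) * L))).
    { apply Rmult_le_compat; auto using pow2_ge_0.
      eapply Rle_trans; [exact HEb|].
      apply Rmult_le_compat_l; lra. }
    assert (Cmod P ^ 2 * Cmod (g * D + H * Cconj Q)%C ^ 2 <= C0 * L * S)
      by (apply Rmult_le_compat; auto using pow2_ge_0).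
    lra. }
  apply herm_nonneg.
  - apply Rmult_le_pos; lra.
  - lra.
  - eapply Rle_trans; [exact Hc|].
    eapply Rle_trans; [apply Rmult_le_compat_r; [exact HL|exact HKb]|].
    apply Rle_trans with (g0 * d * L).
    + apply Rmult_le_compat_r; [exact HL|].
      apply Rmult_le_compat_l; lra.
    + replace (g * L * d) with (g * d * L) by ring.
      apply Rmult_le_compat_r; [exact HL|].
      apply Rmult_le_compat_r; lra.
Qed.

(** Up to the factor [g Cconj Q], the error [E] is the mixed entry [b] minus
    a multiple of [P].  Positivity gives [|b|^2 <= M1 a], and [a] is controlled
    by the value on the tangent vector, which is [g L], together with
    [|P|^2]. *)
Lemma factor_from_psh (P Q G H B E : C) (A D g m : R)
  (M1 g0 g1 q0 W1 : R) :
  let L := herm A B D Q (- P)%C in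
  let a := g * A + 2 * Re (G * Cconj P)%C + m * Cmod P ^ 2 in
  let b := (g * B + G * Cconj Q + Cconj H * P + m * P * Cconj Q)%C in
  let d := g * D + 2 * Re (H * Cconj Q)%C + m * Cmod Q ^ 2 in
  (g * B + G * Cconj Q = g * Cconj Q * E)%C ->
  (forall s t, 0 <= herm a b d s t) ->
  0 < M1 -> d <= M1 -> 0 < g0 -> g0 <= g -> g <= g1 ->
  0 < q0 -> q0 <= Cmod Q ^ 2 ->
  0 < W1 -> Cmod (Cconj H + m * Cconj Q)%C ^ 2 <= W1 -> 0 <= L ->
  Cmod E ^ 2 <= (4 * M1 * (g1 + M1) / q0 + 2 * W1) / (g0 ^ 2 * q0)
                * (L + Cmod P ^ 2).
Proof.
  intros L a b d HE Hpsd HM1 Hd Hg0 Hg Hg1 Hq0 Hq HW1 HW HL.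
  pose proof (herm_offdiag_bound a b d M1 Hpsd HM1 Hd) as Hb.
  pose proof (herm_diag_bound a b d P Q Hpsd) as Ha.
  unfold a, b, d in Ha; rewrite herm_tangent_multiple in Ha.
  fold L in Ha; fold a d in Ha.
  pose proof (pow2_ge_0 (Cmod P)) as HP; pose proof (pow2_ge_0 (Cmod E)) as HE0.
  assert (Ha' : a * Cmod Q ^ 2 <= 2 * (g1 + M1) * (L + Cmod P ^ 2)).
  { assert (g * L <= g1 * L) by (apply Rmult_le_compat_r; lra).
    assert (d * Cmod P ^ 2 <= M1 * Cmod P ^ 2)
      by (apply Rmult_le_compat_r; lra).
    assert (0 <= M1 * L) by (apply Rmult_le_pos; lra).
    assert (0 <= g1 * Cmod P ^ 2) by (apply Rmult_le_pos; lra).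
    lra. }
  assert (Hb' : Cmod b ^ 2 <= 2 * M1 * (g1 + M1) / q0 * (L + Cmod P ^ 2)).
  { apply Rmult_le_reg_l with q0; [lra|].
    replace (q0 * (2 * M1 * (g1 + M1) / q0 * (L + Cmod P ^ 2)))
      with (M1 * (2 * (g1 + M1) * (L + Cmod P ^ 2))) by (field; lra).
    apply Rle_trans with (M1 * (a * Cmod Q ^ 2));
      [|apply Rmult_le_compat_l; lra].
    apply Rle_trans with (Cmod Q ^ 2 * Cmod b ^ 2).
    - apply Rmult_le_compat_r; [apply pow2_ge_0|lra].
    - replace (M1 * (a * Cmod Q ^ 2)) with (Cmod Q ^ 2 * (M1 * a)) by ring.
      apply Rmult_le_compat_l; [lra|exact Hb]. }
  assert (Eb : (g * Cconj Q * E = b - P * (Cconj H + m * Cconj Q))%C)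
    by (rewrite <- HE; unfold b; ring).
  assert (key : g0 ^ 2 * q0 * Cmod E ^ 2
     <= (4 * M1 * (g1 + M1) / q0 + 2 * W1) * (L + Cmod P ^ 2)).
  { apply Rle_trans with (Cmod (g * Cconj Q * E)%C ^ 2).
    - rewrite !Cmod_mult, !Rpow_mult_distr, Cmod_conj, Cmod_R, pow2_abs.
      apply Rmult_le_compat_r; [lra|].
      apply Rmult_le_compat; try lra; [apply pow2_ge_0|].
      apply pow_incr; lra.
    - rewrite Eb; eapply Rle_trans; [apply Cmod_sq_minus|].
      rewrite Cmod_mult, Rpow_mult_distr.
      assert (Cmod P ^ 2 * Cmod (Cconj H + m * Cconj Q)%C ^ 2
              <= Cmod P ^ 2 * W1) by (apply Rmult_le_compat_l; lra).
      assert (0 <= W1 * L) by (apply Rmult_le_pos; lra).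
      replace (4 * M1 * (g1 + M1) / q0)
        with (2 * (2 * M1 * (g1 + M1) / q0)) by (field; lra).
      lra. }
  assert (Hpos : 0 < g0 ^ 2 * q0)
    by (apply Rmult_lt_0_compat; [apply pow_lt|]; lra).
  apply Rmult_le_reg_l with (g0 ^ 2 * q0); [exact Hpos|].
  eapply Rle_trans; [exact key|right; field; lra].
Qed.

(** * From a factor to a plurisubharmonic defining function *)

(** The term [K r] contributes to the derivatives on the zero set only through
    the constant [m = 2 K]. *)
Lemma rescaled_second_order (T r : C2 -> R) (K : R) :
  smooth_near_origin T -> smooth_near_origin r ->
  locally origin (fun p => r p = 0 ->
    second_order_multiple (fun q => (1 + K * r q + T q) * r q) r
      (fun q => 1 + T q) (2 * K) p /\
    (forall k, partial k (fun q => (1 + K * r q + T q) * r q) p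
               = (1 + T p) * partial k r p)).
Proof.
  intros HT Hr.
  set (h := fun q => 1 + K * r q + T q).
  assert (Hh : smooth_near_origin h)
    by (unfold h; auto using smooth_plus, smooth_scal, smooth_const).
  pose proof (smooth_ex_partials _ HT) as LT.
  pose proof (smooth_ex_partials _ Hr) as Lr.
  pose proof (smooth_ex_partials _ Hh) as Lh.
  destruct Hh as (U & HU & U0 & Hh), Hr as (V & HV & V0 & Hr).
  assert (LU : locally origin (fun p => U p /\ V p))
    by (apply (filter_and U V); auto).
  generalize (filter_and _ _ LU (filter_and _ _ Lh (filter_and _ _ LT Lr))).
  apply filter_imp; intros p ([Up Vp] & Eh & ET & Er) r0.
  assert (Dg : forall j, partial j (fun q => 1 + T q) p = partial j T p).
  { intros j; rewrite partial_plus; auto using ex_partial_const.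
    rewrite partial_const; ring. }
  assert (Dh : forall j, partial j h p = partial j T p + K * partial j r p).
  { intros j; unfold h.
    rewrite !partial_plus, partial_const, partial_scal;
      auto using ex_partial_const, ex_partial_plus, ex_partial_mult.
    ring. }
  split.
  - intros j k.
    rewrite (product_second_order h r (fun p => U p /\ V p) p); auto.
    + rewrite !Dg, !Dh; unfold h; rewrite r0; ring.
    + now apply open_and.
    + apply (smooth_on_sub U); [tauto|exact Hh].
    + apply (smooth_on_sub V); [tauto|exact Hr].
  - intros k; fold h.
    change (partial k (fun q => h q * r q) p = (1 + T p) * partial k r p).
    rewrite partial_mult, r0 by auto; unfold h; rewrite r0; ring.
Qed.

(** All the local bounds are taken before [K] is chosen; only the neighborhood
    on which the conclusion holds depends on [K]. *)
Lemma psh_of_admissible (Om : C2 -> Prop) (r T : C2 -> R) (C0 : R) :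
  smooth_on (fun _ => True) r -> (forall p, Om p <-> r p < 0) ->
  0 < partial cv r origin -> boundary Om origin -> 0 < C0 ->
  locally origin (fun p => boundary Om p ->
       (Cmod (d_z (toC r) p)) ^ 2 <= C0 * levi r p) ->
  admissible_factor Om r T ->
  exists K : R, 0 < K /\
    local_psh_defining_function Om (fun p => (1 + K * r p + T p) * r p).
Proof.
  intros Hrs HOm Hv Hb0 HC0 Hlevi (HT & HTpos & E & HE & C1 & HC1 & HEq).
  pose proof (smooth_global _ Hrs) as Hr.
  assert (zero : forall p, boundary Om p -> r p = 0).
  { intros p; apply boundary_zero; auto; intros q; now apply (Hrs O). }
  set (g := fun q => 1 + T q).
  assert (Hg : smooth_near_origin g)
    by (unfold g; auto using smooth_plus, smooth_const).
  destruct (Csmooth_wirtinger _ (Csmooth_toC _ Hr)) as (Hz & _ & Hw & Hwb).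
  destruct (Csmooth_wirtinger _ (Csmooth_toC _ Hg)) as (_ & _ & Hgw & _).
  destruct (Csmooth_wirtinger _ Hwb) as (_ & _ & Hww & _).
  set (D := fun p => Re (d_w (d_wbar (toC r)) p)).
  assert (HD : smooth_near_origin D) by apply Hww.
  set (S := fun p => (RtoC (g p) * RtoC (D p)
    + d_w (toC g) p * Cconj (d_w (toC r) p))%C).
  assert (HS : Csmooth_near_origin S).
  { apply Csmooth_plus; apply Csmooth_mult; auto using Csmooth_conj;
    now apply Csmooth_toC. }
  destruct (smooth_bounded_above _ (Csmooth_sq _ HS)) as (Sb & HSb & LS).
  set (N := fun p => (g p * Cmod (d_w (toC r) p) ^ 2) ^ 2).
  assert (HN : smooth_near_origin N).
  { apply (smooth_ext (fun p => (g p * Cmod (d_w (toC r) p) ^ 2)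
             * (g p * Cmod (d_w (toC r) p) ^ 2))).
    - intros p; unfold N; ring.
    - auto using smooth_mult, Csmooth_sq. }
  destruct (smooth_bounded_above _ HN) as (Nb & HNb & LN).
  set (D' := fun p => - (g p * D p
    + 2 * Re (d_w (toC g) p * Cconj (d_w (toC r) p))%C)).
  assert (HD' : smooth_near_origin D').
  { apply (smooth_ext (fun p => (-1) * (g p * D p
      + 2 * Re (d_w (toC g) p * Cconj (d_w (toC r) p))%C))).
    - intros p; unfold D'; ring.
    - apply smooth_scal, smooth_plus; [now apply smooth_mult|].
      apply smooth_scal.
      apply (Csmooth_mult _ _ Hgw (Csmooth_conj _ Hw)). }
  destruct (smooth_bounded_above _ HD') as (Db & HDb & LD).
  assert (g00 : 0 < g origin) by exact (locally_singleton _ _ HTpos).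
  pose proof (greater_near g origin (g origin / 2)
    (smooth_continuous _ Hg) ltac:(lra)) as Lg.
  pose proof (d_w_sq_pos r origin Hv) as q00.
  set (q0 := Cmod (d_w (toC r) origin) ^ 2) in *.
  pose proof (greater_near (fun p => Cmod (d_w (toC r) p) ^ 2) origin (q0 / 2)
    (smooth_continuous _ (Csmooth_sq _ Hw)) ltac:(cbv beta; fold q0; lra)) as Lq.
  set (M := 2 * Nb * C1 * (1 + C0) + 2 * Sb * C0).
  assert (HM : 0 < M).
  { assert (0 < Nb * C1) by (apply Rmult_lt_0_compat; lra).
    assert (0 < Nb * C1 * C0) by (apply Rmult_lt_0_compat; lra).
    assert (0 < Sb * C0) by (apply Rmult_lt_0_compat; lra).
    unfold M; lra. }
  (* Solves [g0 * (2 * K * q1 - Db) = M] for the lower bounds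
     [g0 = g origin / 2] of [g] and [q1 = q0 / 2] of [Cmod (r_w) ^ 2]. *)
  set (K := (M / (g origin / 2) + Db) / q0).
  assert (HMg : 0 < M / (g origin / 2)) by (apply Rdiv_lt_0_compat; lra).
  assert (HK : 0 < K) by (apply Rdiv_lt_0_compat; lra).
  exists K; split; [exact HK|].
  set (rho := fun p => (1 + K * r p + T p) * r p).
  assert (Hh : smooth_near_origin (fun p => 1 + K * r p + T p))
    by auto using smooth_plus, smooth_scal, smooth_const.
  assert (Hrho : smooth_near_origin rho) by (now apply smooth_mult).
  pose proof (greater_near _ origin 0 (smooth_continuous _ Hh)
    ltac:(cbv beta; rewrite (zero _ Hb0); unfold g in g00; lra)) as Lh.
  pose proof (greater_near _ origin 0
    (smooth_continuous _ (smooth_partial cv _ Hr)) Hv) as Lv.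
  pose proof (smooth_mixed_symmetric _ Hrho) as Lsym.
  pose proof (rescaled_second_order T r K HT Hr) as Lrel.
  pose proof (smooth_ex_partials _ HT) as LT.
  destruct Hrho as (U & HU & U0 & Hrho).
  set (good := fun p =>
    (0 < 1 + K * r p + T p) /\
    (boundary Om p -> grad_nonzero rho p /\ hessian_psd rho p)).
  assert (Lgood : locally origin good).
  { generalize (filter_and _ _ LT (filter_and _ _ Lh (filter_and _ _ Lv
      (filter_and _ _ Lsym (filter_and _ _ Lrel (filter_and _ _ Lg
      (filter_and _ _ Lq (filter_and _ _ LS (filter_and _ _ LN
      (filter_and _ _ LD (filter_and _ _ Hlevi HEq))))))))))).
    apply filter_imp.
    intros p (ET & Ph & Pv & Psym & Prel & Pg & Pq & PS & PN & PD & Pl & PE).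
    split; [exact Ph|intros Hb].
    pose proof (zero p Hb) as r0.
    destruct (Prel r0) as [Hrel Hgrad]; fold rho in Hrel, Hgrad; fold g in Hrel.
    split.
    - exists cv; rewrite Hgrad; fold (g p).
      apply Rmult_integral_contrapositive; lra.
    - intros s t; rewrite Re_hessian_form by exact Psym.
      destruct (hessian_multiple _ _ _ _ _ Hrel) as (-> & -> & ->).
      specialize (Pl Hb); destruct (PE Hb) as [PEq PEb].
      rewrite levi_herm in Pl, PEb.
      apply (psh_from_factor _ _ _ _ _ (E p) _ _ _ _ C0 C1 (g origin / 2)
               (q0 / 2) Nb Sb Db); auto; try lra.
      + pose proof (d_wbar_neq0 r p Pv) as NQ.
        rewrite <- d_wbar_conj.
        assert (Ng : RtoC (g p) <> RtoC 0).
        { intros X; apply (f_equal fst) in X; simpl in X; lra. }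
        replace (d_z (toC g) p) with (d_z (toC T) p).
        * replace (d_z (toC T) p) with
            (RtoC (g p) * (d_z (toC T) p / RtoC (1 + T p)))%C
            by (fold (g p); field; exact Ng).
          rewrite PEq; field; exact NQ.
        * rewrite !d_z_toC; unfold g.
          rewrite !partial_plus, !partial_const; auto using ex_partial_const.
          f_equal; ring.
      + fold M; unfold K; right; field; lra. }
  exists (fun p => U p /\ locally p good); split; [|split; [|split; [|split]]].
  - apply open_and; auto using open_interior.
  - auto.
  - apply (smooth_on_sub U); [tauto|exact Hrho].
  - intros p [_ Hp]; apply locally_singleton in Hp; destruct Hp as [Hp _].
    rewrite HOm; unfold rho; split; intros H.
    + assert (0 < (1 + K * r p + T p) * - r p)
        by (apply Rmult_lt_0_compat; lra); lra.
    + apply Rnot_le_lt; intros H'.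
      assert (0 <= (1 + K * r p + T p) * r p)
        by (apply Rmult_le_pos; lra); lra.
  - intros p [_ Hp]; apply locally_singleton in Hp; apply Hp.
Qed.

(** * From a plurisubharmonic defining function to a factor *)

(** Here [1 + T] is the quotient of the last partial derivatives.  It agrees on
    the boundary with the smooth quotient [rho / r], and the two differ by a multiple
    of [r], which changes [T_z] there by [O(|r_z|)], within the tolerance of [E].
    With this choice the smoothness of [T] is immediate. *)
Lemma admissible_of_psh (Om : C2 -> Prop) (r rho : C2 -> R) (C0 : R) :
  smooth_on (fun _ => True) r -> (forall p, Om p <-> r p < 0) ->
  0 < partial cv r origin -> boundary Om origin -> 0 < C0 ->
  locally origin (fun p => boundary Om p ->
       (Cmod (d_z (toC r) p)) ^ 2 <= C0 * levi r p) ->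
  local_psh_defining_function Om rho ->
  admissible_factor Om r
    (fun p => partial cv rho p * / partial cv r p - 1).
Proof.
  intros Hrs HOm Hv Hb0 HC0 Hlevi (V & HV & V0 & Hrhos & Hsign & Hpsd).
  pose proof (smooth_global _ Hrs) as Hr.
  assert (Hrho : smooth_near_origin rho) by (now exists V).
  assert (zero : forall p, boundary Om p -> r p = 0).
  { intros p; apply boundary_zero; auto; intros q; now apply (Hrs O). }
  assert (same : forall p, V p -> (r p < 0 <-> rho p < 0))
    by (intros p Vp; rewrite <- HOm; auto).
  set (g := fun p => partial cv rho p * / partial cv r p).
  assert (Hg : smooth_near_origin g).
  { apply smooth_mult; [now apply smooth_partial|].
    apply smooth_inv; [now apply smooth_partial|lra]. }
  set (T := fun p => g p - 1).
  assert (HT : smooth_near_origin T)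
    by (apply smooth_plus; auto using smooth_const).
  assert (g1 : forall p, 1 + T p = g p) by (intros p; unfold T; ring).
  change (admissible_factor Om r T).
  pose proof (greater_near _ origin 0
    (smooth_continuous _ (smooth_partial cv _ Hr)) Hv) as Lv.
  destruct Hg as (W & HW & W0 & Hgs).
  assert (Hg : smooth_near_origin g) by (now exists W).
  set (U := fun p => (V p /\ W p) /\ locally p (fun q => 0 < partial cv r q)).
  assert (HU : open U)
    by (apply open_and; [now apply open_and|apply open_interior]).
  assert (U0 : U origin) by (repeat split; auto).
  assert (Uv : forall q, U q -> 0 < partial cv r q)
    by (intros q [_ Hq]; now apply locally_singleton in Hq).
  assert (UV : forall q, U q -> V q) by (intros q Hq; apply Hq).
  assert (UW : forall q, U q -> W q) by (intros q Hq; apply Hq).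
  assert (Urho : forall q, U q -> r q = 0 -> rho q = 0).
  { intros q Uq; apply (same_sign_same_zeros V rho r q); auto.
    - now apply (Hrhos O), UV.
    - now apply (Hrs 1%nat). }
  assert (rel : forall p, U p -> r p = 0 ->
    (forall k, partial k rho p = g p * partial k r p) /\
    second_order_multiple rho r g (- (partial cv g p * / partial cv r p)) p).
  { intros p; apply (zero_set_second_order rho r U p); auto.
    - now apply (smooth_on_sub V).
    - now apply (smooth_on_sub (fun _ => True)).
    - now apply (smooth_on_sub W). }
  assert (r0 : r origin = 0) by auto.
  assert (g00 : 0 < g origin).
  { assert (0 <= partial cv rho origin).
    { apply (same_sign_gradient V rho r); auto.
      - now apply (Hrhos 1%nat).
      - now apply (Hrs 1%nat). }
    destruct (Hpsd origin V0 Hb0) as [[k Hk] _].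
    destruct (rel origin U0 r0) as [E _]; rewrite E in Hk.
    assert (g origin <> 0) by (intros X; apply Hk; rewrite X; ring).
    assert (0 <= g origin); [|lra].
    apply Rmult_le_pos; [lra|]; apply Rlt_le, Rinv_0_lt_compat; lra. }
  pose proof (greater_near g origin (g origin / 2)
    (smooth_continuous _ Hg) ltac:(lra)) as Lg.
  destruct (Csmooth_wirtinger _ (Csmooth_toC _ Hr)) as (Hz & _ & Hw & Hwb).
  destruct (Csmooth_wirtinger _ (Csmooth_toC _ HT)) as (HTz & _ & _ & _).
  destruct (Csmooth_wirtinger _ (Csmooth_toC _ Hg)) as (_ & _ & Hgw & _).
  destruct (Csmooth_wirtinger _ Hwb) as (Hzw & _ & _ & _).
  assert (Hrhoww : Csmooth_near_origin (d_w (d_wbar (toC rho)))).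
  { destruct (Csmooth_wirtinger _ (Csmooth_toC _ Hrho)) as (_ & _ & _ & X).
    apply (Csmooth_wirtinger _ X). }
  pose proof (d_w_sq_pos r origin Hv) as q00.
  set (q0 := Cmod (d_w (toC r) origin) ^ 2) in *.
  pose proof (greater_near (fun p => Cmod (d_w (toC r) p) ^ 2) origin (q0 / 2)
    (smooth_continuous _ (Csmooth_sq _ Hw)) ltac:(cbv beta; fold q0; lra)) as Lq.
  destruct (smooth_bounded_above _ Hg) as (gb & Hgb & Lgb).
  destruct (smooth_bounded_above _ (proj1 Hrhoww)) as (Mb & HMb & LM).
  set (m := fun p => - (partial cv g p * / partial cv r p)).
  assert (Hm : smooth_near_origin m).
  { apply (smooth_ext (fun p => (-1) * (partial cv g p * / partial cv r p))).
    - intros p; unfold m; ring.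
    - apply smooth_scal, smooth_mult; [now apply smooth_partial|].
      apply smooth_inv; [now apply smooth_partial|lra]. }
  set (X := fun p => (Cconj (d_w (toC g) p)
                      + RtoC (m p) * Cconj (d_w (toC r) p))%C).
  assert (HX : Csmooth_near_origin X).
  { apply Csmooth_plus; [now apply Csmooth_conj|].
    apply Csmooth_mult; [now apply Csmooth_toC|now apply Csmooth_conj]. }
  destruct (smooth_bounded_above _ (Csmooth_sq _ HX)) as (Xb & HXb & LX).
  split; [exact HT|split].
  { revert Lg; apply filter_imp; intros p Hp; rewrite g1; lra. }
  set (E := fun p => (d_z (toC T) p / RtoC (1 + T p)
                      + d_z (d_wbar (toC r)) p / d_wbar (toC r) p)%C).
  exists E; split.
  { apply Csmooth_plus; apply Csmooth_mult; auto; apply Csmooth_inv; auto.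
    - apply Csmooth_toC, smooth_plus; auto using smooth_const.
    - rewrite g1; intros Y; apply (f_equal fst) in Y; simpl in Y; lra.
    - now apply d_wbar_neq0. }
  exists ((4 * Mb * (gb + Mb) / (q0 / 2) + 2 * Xb)
          / ((g origin / 2) ^ 2 * (q0 / 2))).
  split.
  { assert (0 < Mb * (gb + Mb)) by (apply Rmult_lt_0_compat; lra).
    assert (0 < 4 * Mb * (gb + Mb) / (q0 / 2))
      by (apply Rdiv_lt_0_compat; lra).
    apply Rdiv_lt_0_compat; [lra|].
    apply Rmult_lt_0_compat; [apply pow_lt|]; lra. }
  generalize (filter_and _ _ (HU _ U0) (filter_and _ _ Lg (filter_and _ _ Lgb
    (filter_and _ _ Lq (filter_and _ _ LM (filter_and _ _ LX
    (filter_and _ _ (smooth_mixed_symmetric _ Hrho) (filter_and _ _ Hlevi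
    (smooth_ex_partials _ Hg))))))))).
  apply filter_imp.
  intros p (Up & Pg & Pgb & Pq & PM & PX & Psym & Pl & Pex) Hb.
  split; [unfold E; ring|].
  specialize (Pl Hb); rewrite levi_herm in Pl |- *.
  destruct (rel p Up (zero p Hb)) as [_ Hrel]; fold (m p) in Hrel.
  destruct (Hpsd p (UV p Up) Hb) as [_ Hh].
  pose proof (fun s t => eq_rect _ (fun x => 0 <= x) (Hh s t) _
                (Re_hessian_form rho p s t Psym)) as Hform.
  destruct (hessian_multiple _ _ _ _ _ Hrel) as (Ea & Eb & Ed).
  rewrite Ed in PM; rewrite Ea, Eb, Ed in Hform.
  apply (factor_from_psh _ _ (d_z (toC g) p) (d_w (toC g) p) _ _ _ _ (g p) (m p));
    auto; try lra.
  - rewrite <- d_wbar_conj; unfold E; rewrite g1.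
    pose proof (d_wbar_neq0 r p (Uv p Up)) as NQ.
    assert (Ng : RtoC (g p) <> RtoC 0).
    { intros Y; apply (f_equal fst) in Y; simpl in Y; lra. }
    replace (d_z (toC T) p) with (d_z (toC g) p).
    + field; auto.
    + rewrite !d_z_toC; unfold T, Rminus.
      rewrite !partial_plus, !partial_const; auto using ex_partial_const.
      f_equal; ring.
  - pose proof (pow2_ge_0 (Cmod (d_z (toC r) p))).
    apply Rmult_le_reg_l with C0; lra.
Qed.

Theorem theorem4p4 (Om : C2 -> Prop) (r F : C2 -> R)
  (hr : defining_function Om r)
  (h0 : boundary Om origin)
  (hrF : forall p : C2, r p = Im (snd p) + F p)
  (hFsmooth : smooth_on (fun _ => True) F)
  (hF0 : F origin = 0)
  (hF1 : forall k : coord, partial k F origin = 0)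
  (hlevi : exists C0 : R, 0 < C0 /\
     locally origin (fun p => boundary Om p ->
       (Cmod (d_z (toC r) p)) ^ 2 <= C0 * levi r p)) :
  ((exists rho : C2 -> R, local_psh_defining_function Om rho) <->
   (exists T : C2 -> R, admissible_factor Om r T))
  /\
  (forall T : C2 -> R, admissible_factor Om r T ->
     exists K : R, 0 < K /\
       local_psh_defining_function Om (fun p => (1 + K * r p + T p) * r p)).
Proof.
  destruct hr as (Hr & HOm & _), hlevi as (C0 & HC0 & Hlevi).
  assert (Hv : 0 < partial cv r origin).
  { rewrite (functional_extensionality _ _ hrF).
    assert (Hid : ex_partial cv (fun p => Im (snd p)) origin)
      by exact (ex_derive_id _).
    rewrite partial_plus, hF1; auto.
    - unfold partial; simpl; rewrite Derive_id; lra.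
    - now apply (hFsmooth 1%nat). }
  assert (back : forall T, admissible_factor Om r T -> exists K : R, 0 < K /\
       local_psh_defining_function Om (fun p => (1 + K * r p + T p) * r p))
    by (intros T HT; now apply (psh_of_admissible Om r T C0)).
  split; [split|exact back].
  - intros [rho Hrho].
    eexists; now apply (admissible_of_psh Om r rho C0).
  - intros [T HT]; destruct (back T HT) as (K & _ & H); eauto.
Qed.
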